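(* Let $0\leq\varepsilon<1$ and $0<\varepsilon_0<1$, and suppose that $$\tfrac13 h_t^2\Big(\tfrac{a_1^2}{h_1^2}+\ldots+\tfrac{a_n^2}{h_n^2}\Big)\leq 1-\varepsilon\qquad\text{and}\qquad \tfrac14 h_t^2A_{\mathbf h}\leq(1-\varepsilon_0^2)I\ \text{ in }H_h .$$ Let $f_{\mathbf h},b_1,\ldots,b_n:\{t_m\}_{m=0}^{M-1}\to H_h$ and $v^0,u_{1\mathbf h}\in H_h$ be arbitrary. Let $v:\{t_m\}_{m=0}^{M}\to H_h$ (with the given $v^0$) and $v_{11},\ldots,v_{nn}:\{t_m\}_{m=0}^{M-1}\to H_h$ satisfy $$\Lambda_tv^m=\big(I+\tfrac1{12}h_t^2L_h\big)\big(a_1^2v_{11}^m+\ldots+a_n^2v_{nn}^m\big)+f_{\mathbf h}^m\ \text{ on }\omega_h,\quad 1\leq m\leq M-1,$$ $$s_{kN}v_{kk}^m=\Lambda_kv^m+b_k^m\ \text{ on }\omega_h,\quad 0\leq m\leq M-1,\ 1\leq k\leq n,$$ $$(\delta_tv)^0=\tfrac12h_t\big(I+\tfrac1{12}h_t^2L_h\big)\big(a_1^2v_{11}^0+\ldots+a_n^2v_{nn}^0\big)+u_{1\mathbf h}+\tfrac12h_tf_{\mathbf h}^0\ \text{ on }\omega_h.$$ Set $\beta_{\mathbf h}:=\big(I+\tfrac1{12}h_t^2L_h\big)\big(a_1^2s_{1N}^{-1}b_1+\ldots+a_n^2s_{nN}^{-1}b_n\big)$ in $H_h$ on $\{t_m\}_{m=0}^{M-1}$.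 Then the stability bound $$\max_{1\leq m\leq M}\big(\varepsilon_0^2\|\bar\delta_tv^m\|_{\bar s_N}^2+\|\bar s_tv^m\|_{\widetilde A_N}^2\big)^{1/2}\leq\big(\|v^0\|_{\widetilde A_N}^2+\varepsilon_0^{-2}\|u_{1\mathbf h}\|_{\bar s_N}^2\big)^{1/2}+2\varepsilon_0^{-1}\big\|\bar s_N^{\,1/2}(f_{\mathbf h}+\beta_{\mathbf h})\big\|_{L^1_{h_t}(H_h)}$$ holds, and, for $1\leq m\leq M$, the discrete energy conservation law $$\|\bar\delta_tv^m\|_{\bar s_N}^2-\tfrac14h_t^2\|\bar\delta_tv^m\|_{\widetilde A_N}^2+\|\bar s_tv^m\|_{\widetilde A_N}^2=\big(\widetilde A_Nv^0,s_tv^0\big)_h+\big(\bar s_Nu_{1\mathbf h},\delta_tv^0\big)_h$$ $$+\tfrac12h_t\big(\bar s_N(f_{\mathbf h}^0+\beta_{\mathbf h}^0),\delta_tv^0\big)_h+2I_{h_t}^{m-1}\big(\bar s_N(f_{\mathbf h}+\beta_{\mathbf h}),\mathring\delta_tv\big)_h$$ holds.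
   Context: Let $n\geq1$, $a_k>0$, $X_k>0$ ($1\leq k\leq n$), $T>0$ be constants and $\Omega=(0,X_1)\times\ldots\times(0,X_n)$. Time mesh: $t_m=mh_t$, $0\leq m\leq M$, $h_t=T/M$, $M\geq2$. For a function $y$ of the time mesh write $y^m=y(t_m)$ and $\bar s_ty^m=\tfrac12(y^{m-1}+y^m)$, $s_ty^m=\tfrac12(y^m+y^{m+1})$, $\bar\delta_ty^m=\frac{y^m-y^{m-1}}{h_t}$, $\delta_ty^m=\frac{y^{m+1}-y^m}{h_t}$, $\mathring\delta_ty^m=\frac{y^{m+1}-y^{m-1}}{2h_t}$, $\Lambda_ty^m=\frac{y^{m+1}-2y^m+y^{m-1}}{h_t^2}$. Summation operator: $I_{h_t}^my=h_t\sum_{l=1}^my^l$ for $m\geq1$, $I_{h_t}^0y=0$. Space mesh: $x_{kl}=lh_k$, $0\leq l\leq N_k$, $h_k=X_k/N_k$, $N_k\geq2$ an integer; $\bar\omega_h$ is the product of the one-dimensional meshes $\{x_{kl}\}_{l=0}^{N_k}$, $1\le k\le n$, $\omega_h$ is the product of $\{x_{kl}\}_{l=1}^{N_k-1}$, and $\partial\omega_h=\bar\omega_h\setminus\omega_h$; $h=(h_1,\ldots,h_n)$, $\mathbf h=(h,h_t)$. In the direction $x_k$ on $\omega_h$: $(\Lambda_kw)_l=\frac{1}{h_k^2}(w_{l+1}-2w_l+w_{l-1})$ and the Numerov average $s_{kN}w_l=\frac1{12}(w_{l-1}+10w_l+w_{l+1})$, i.e. $s_{kN}=I+\frac1{12}h_k^2\Lambda_k$.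 Also $L_h=a_1^2\Lambda_1+\ldots+a_n^2\Lambda_n$; $I$ is the identity. $H_h$ is the Euclidean space of real functions on $\bar\omega_h$ vanishing on $\partial\omega_h$ with inner product $(v,w)_h=h_1\cdots h_n\sum_{x\in\omega_h}v(x)w(x)$ and norm $\|w\|_h=(w,w)_h^{1/2}$. The operators $\Lambda_k,s_{kN},L_h$ are regarded as operators in $H_h$ (values on $\partial\omega_h$ set to $0$); $s_{kN}$ is invertible in $H_h$. Operator inequalities in $H_h$ are in the sense of quadratic forms. For $C_h=C_h^*>0$ in $H_h$, $\|w\|_{C_h}=(C_hw,w)_h^{1/2}$ and $C_h^{1/2}$ is the positive square root. Operators in $H_h$: $A_{\mathbf h}:=\big(I+\tfrac1{12}h_t^2L_h\big)\big(-a_1^2s_{1N}^{-1}\Lambda_1-\ldots-a_n^2s_{nN}^{-1}\Lambda_n\big)$; $\bar s_N:=s_{1N}\cdots s_{nN}$; $\bar s_{N\widehat l}:=\prod_{1\leq k\leq n,\,k\neq l}s_{kN}$; $\bar A_N:=-\big(a_1^2\bar s_{N\widehat1}\Lambda_1+\ldots+a_n^2\bar s_{N\widehat n}\Lambda_n\big)$; $\widetilde A_N:=\big(I+\tfrac1{12}h_t^2L_h\big)\bar A_N$. The operators $\bar s_N$ and, under the first displayed condition of the claim, $A_{\mathbf h}$ and $\widetilde A_N$ are self-adjoint and positive definite in $H_h$. For $y:\{t_m\}_{m=0}^{M-1}\to H_h$: $\|y\|_{L^1_{h_t}(H_h)}:=\tfrac14h_t\|y^0\|_h+I_{h_t}^{M-1}\|y\|_h=\tfrac14h_t\|y^0\|_h+h_t\sum_{l=1}^{M-1}\|y^l\|_h$.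 *)

(* Defs.v *)
From HB Require Import structures.
From mathcomp Require Import all_boot all_order all_algebra.
From mathcomp Require Import boolp classical_sets reals.
From mathcomp Require Import ring lra.
Set Implicit Arguments.
Unset Strict Implicit.
Unset Printing Implicit Defensive.
Import Order.TTheory GRing.Theory Num.Theory.
Local Open Scope ring_scope.

(* A node of the closed mesh is its multi-index x: its k-th coordinate is
   x k * h k, with 0 <= x k <= N k. *)
Definition mesh (n : nat) (N : 'I_n -> nat) : finType :=
  {dffun forall k : 'I_n, 'I_(N k).+1}.

Definition omega (n : nat) (N : 'I_n -> nat) : {set mesh N} :=
  [set x : mesh N | [forall k, (0 < x k < N k)%N]].

(* The neighbours of x in the direction k; only used at interior nodes, where
   the truncations in inord and in the subtraction are not active. *)
Definition nbr_next (n : nat) (N : 'I_n -> nat) (k : 'I_n) (x : mesh N) :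
    mesh N := [ffun i : 'I_n => inord (x i + (i == k)) : 'I_(N i).+1].
Definition nbr_prev (n : nat) (N : 'I_n -> nat) (k : 'I_n) (x : mesh N) :
    mesh N := [ffun i : 'I_n => inord (x i - (i == k)) : 'I_(N i).+1].

Notation mesh_fun R N := {ffun mesh N -> R^o}.

Section Space.
Variables (R : realType) (n : nat) (N : 'I_n -> nat).
Local Notation mesh_fun := (mesh_fun R N).

Definition bnd_part (w : mesh_fun) : mesh_fun :=
  [ffun x => if x \in omega N then 0 else w x].

Fact bnd_part_linear : linear bnd_part.
Proof.
move=> c u v; apply/ffunP => x; rewrite !ffunE.
by case: ifP => _; rewrite ?ffunE // scaler0 addr0.
Qed.
HB.instance Definition _ :=
  GRing.isLinear.Build R mesh_fun mesh_fun *:%R bnd_part bnd_part_linear.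

(* The mesh functions that vanish on the boundary: see mem_Hspace. *)
Definition Hspace : {vspace mesh_fun} := lker (linfun bnd_part).

Lemma mem_Hspace (w : mesh_fun) :
  reflect (forall x, x \notin omega N -> w x = 0) (w \in Hspace).
Proof.
rewrite memv_ker lfunE /=; apply: (iffP eqP) => [w0 x xB|w0].
  by have /ffunP/(_ x) := w0; rewrite !ffunE (negbTE xB).
apply/ffunP => x; rewrite !ffunE; case: ifPn => // xB; exact: w0.
Qed.

End Space.

Notation Hh R N := (subvs_of (Hspace R N)).

Section Operators.
Variables (R : realType) (n : nat) (N : 'I_n -> nat).
Local Notation mesh_fun := (mesh_fun R N).
Local Notation Hh := (Hh R N).

Definition Hval (w : Hh) : mesh N -> R := fun_of_fin (vsval w).

(* The operator in Hh whose values on omega are given by F and whose values on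
   the boundary are set to 0.  linfun is meaningful only for a linear F; see
   LambdaE and sNE for the two instances. *)
Definition restr_omega (F : mesh_fun -> mesh N -> R) (w : Hh) : Hh :=
  vsproj (Hspace R N) [ffun x => if x \in omega N then F (vsval w) x else 0].
Definition Hop (F : mesh_fun -> mesh N -> R) : 'End(Hh) :=
  linfun (restr_omega F).

Variable h : 'I_n -> R.

Definition Lambda_pt (k : 'I_n) (w : mesh_fun) (x : mesh N) : R :=
  (w (nbr_next k x) - 2 * w x + w (nbr_prev k x)) / h k ^+ 2.
Definition sN_pt (k : 'I_n) (w : mesh_fun) (x : mesh N) : R :=
  (w (nbr_prev k x) + 10 * w x + w (nbr_next k x)) / 12.

Definition Lambda (k : 'I_n) : 'End(Hh) := Hop (Lambda_pt k).
Definition sN (k : 'I_n) : 'End(Hh) := Hop (sN_pt k).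

Lemma HopE (F : mesh_fun -> mesh N -> R) :
  (forall c u v x, F (c *: u + v) x = c * F u x + F v x) ->
  forall (w : Hh) x,
  Hval (Hop F w) x = if x \in omega N then F (vsval w) x else 0.
Proof.
move=> linF w x.
have lin : linear (restr_omega F).
  move=> c u v; rewrite /restr_omega -linearP; congr (vsproj _ _).
  apply/ffunP => y; rewrite !ffunE linearP.
  by case: ifP => _; rewrite ?linF // scaler0 addr0.
pose L := GRing.isLinear.Build R Hh Hh *:%R (restr_omega F) lin.
pose f : {linear Hh -> Hh} := HB.pack (restr_omega F) L.
have -> : Hop F w = restr_omega F w by rewrite /Hop -[restr_omega F]/(f : _ -> _) lfunE.
rewrite /Hval /restr_omega vsprojK ?ffunE //.
by apply/mem_Hspace => y yB; rewrite ffunE (negbTE yB).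
Qed.

Lemma LambdaE k (w : Hh) x : Hval (Lambda k w) x =
  if x \in omega N then
    (Hval w (nbr_next k x) - 2 * Hval w x + Hval w (nbr_prev k x)) / h k ^+ 2
  else 0.
Proof.
rewrite HopE // => c u v y; rewrite /Lambda_pt !ffunE.
rewrite /GRing.scale /=; ring.
Qed.

Lemma sNE k (w : Hh) x : Hval (sN k w) x =
  if x \in omega N then
    (Hval w (nbr_prev k x) + 10 * Hval w x + Hval w (nbr_next k x)) / 12
  else 0.
Proof.
rewrite HopE // => c u v y; rewrite /sN_pt !ffunE.
rewrite /GRing.scale /=; ring.
Qed.

(* Hence the library inverse (sN k)^-1 is a two-sided inverse. *)
Lemma lker_sN k : lker (sN k) == 0%VS.
Proof.
rewrite -subv0; apply/subvP => w; rewrite memv_ker memv0 => /eqP sNw0.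
have sN0 x : x \in omega N ->
    10 * Hval w x = - (Hval w (nbr_prev k x) + Hval w (nbr_next k x)).
  move=> xI; have := sNE k w x; rewrite sNw0 xI [LHS]ffunE.
  move=> /esym/eqP; rewrite mulf_eq0 invr_eq0 pnatr_eq0 orbF addrAC addrC.
  by rewrite addr_eq0 => /eqP.
pose x0 : mesh N := [ffun i : 'I_n => ord0 : 'I_(N i).+1].
have [y _ ymax] :=
  @Order.TotalTheory.arg_maxP _ _ _ x0 xpredT (fun x => `|Hval w x|) isT.
have y0 : Hval w y = 0.
  have [yI|yB] := boolP (y \in omega N); last first.
    by have /mem_Hspace := subvsP w; apply.
  have : `|10 * Hval w y| <= `|Hval w y| + `|Hval w y|.
    rewrite sN0 // normrN (le_trans (ler_normD _ _)) // lerD //; exact: ymax.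
  rewrite normrM ger0_norm ?ler0n // => le10.
  apply/eqP; rewrite -normr_le0.
  by have := normr_ge0 (Hval w y); lra.
apply/eqP; apply: val_inj => /=; apply/ffunP => x.
rewrite ffunE; apply/eqP; rewrite -[_ == 0]normr_le0 -(@normr0 R R) -y0.
exact: ymax.
Qed.

Definition Lh (a : 'I_n -> R) : 'End(Hh) := \sum_k a k ^+ 2 *: Lambda k.

Definition Bh (a : 'I_n -> R) (ht : R) : 'End(Hh) :=
  (\1 + (ht ^+ 2 / 12) *: Lh a)%VF.

(* The operators sN k commute, so the order in the products is irrelevant. *)
Definition sbarN : 'End(Hh) := (\big[@comp_lfun _ _ _ _ / \1]_(k < n) sN k)%VF.
Definition sbarN_hat (l : 'I_n) : 'End(Hh) :=
  (\big[@comp_lfun _ _ _ _ / \1]_(k < n | k != l) sN k)%VF.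

Definition Ah (a : 'I_n -> R) (ht : R) : 'End(Hh) :=
  (Bh a ht \o (- \sum_k a k ^+ 2 *: ((sN k)^-1 \o Lambda k)))%VF.
Definition AbarN (a : 'I_n -> R) : 'End(Hh) :=
  (- \sum_k a k ^+ 2 *: (sbarN_hat k \o Lambda k))%VF.
Definition AtildeN (a : 'I_n -> R) (ht : R) : 'End(Hh) :=
  (Bh a ht \o AbarN a)%VF.

Definition ip (v w : Hh) : R :=
  (\prod_k h k) * \sum_(x in omega N) Hval v x * Hval w x.
Definition nrm (w : Hh) : R := Num.sqrt (ip w w).
Definition nrm_op (C : 'End(Hh)) (w : Hh) : R := Num.sqrt (ip (C w) w).

Definition op_le (C D : 'End(Hh)) : Prop :=
  forall w, ip (C w) w <= ip (D w) w.
Definition self_adjoint (C : 'End(Hh)) : Prop :=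
  forall v w, ip (C v) w = ip v (C w).
Definition pos_def (C : 'End(Hh)) : Prop :=
  forall w, w != 0 -> 0 < ip (C w) w.

(* The positive square root, unique when it exists (0 when it does not). *)
Definition op_sqrt (C : 'End(Hh)) : 'End(Hh) :=
  xget 0 [set S : 'End(Hh) |
    [/\ self_adjoint S, pos_def S & (S \o S)%VF = C]]%classic.

Definition Iht (ht : R) (m : nat) (y : nat -> R) : R :=
  ht * \sum_(1 <= l < m.+1) y l.
(* For y on {t_0, ..., t_(M-1)}: the later values of y are ignored. *)
Definition L1nrm (ht : R) (M : nat) (y : nat -> Hh) : R :=
  ht / 4 * nrm (y 0%N) + Iht ht M.-1 (fun l => nrm (y l)).

Definition beta (a : 'I_n -> R) (ht : R) (b : 'I_n -> nat -> Hh) (m : nat) :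
    Hh := Bh a ht (\sum_k a k ^+ 2 *: ((sN k)^-1)%VF (b k m)).

End Operators.

(* Functions of the time mesh are sequences y with y m the value at t_m.  The
   operators involving y m.-1 are meant for 1 <= m. *)
Section Time.
Variables (R : realType) (V : lmodType R) (ht : R) (y : nat -> V).

Definition st_bar (m : nat) : V := 2^-1 *: (y m.-1 + y m).
Definition st (m : nat) : V := 2^-1 *: (y m + y m.+1).
Definition dt_bar (m : nat) : V := ht^-1 *: (y m - y m.-1).
Definition dt (m : nat) : V := ht^-1 *: (y m.+1 - y m).
Definition dt_ring (m : nat) : V := (2 * ht)^-1 *: (y m.+1 - y m.-1).
Definition Lambda_t (m : nat) : V :=
  (ht ^+ 2)^-1 *: (y m.+1 - 2 *: y m + y m.-1).

End Time.

(* Main.v *)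
Require Import Defs.
From HB Require Import structures.
From mathcomp Require Import all_boot all_order all_algebra.
From mathcomp Require Import boolp classical_sets reals.
From mathcomp Require Import complex ring lra.
Set Implicit Arguments.
Unset Strict Implicit.
Unset Printing Implicit Defensive.
Import Order.TTheory GRing.Theory Num.Theory.
Local Open Scope ring_scope.

(** Eliminating the [v_kk] and applying [sbarN] turns the scheme into
    [sbarN (Lambda_t v) + AtildeN v = sbarN g].  Pairing it with the central
    difference of [v] telescopes into the energy law.  By the second stability
    condition the energy dominates the left-hand side of the bound, and
    Cauchy-Schwarz on the right-hand side of the energy law gives
    [Q ^ 2 <= B * Q] for the maximum [Q] and the bound [B].

    The positivity of the operators comes from square roots: a positive [P] has
    a positive square root that is a polynomial in [P], so it commutes with all
    that commutes with [P], and products of commuting positive operators are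
    positive.  That polynomial interpolates the root on the spectrum: for a
    symmetric operator, repeated linear factors and quadratic factors without
    real roots cancel from any annihilating polynomial. *)

(** * Linear and quadratic factors of real polynomials *)

Section RealRoots.
Local Open Scope complex_scope.
Variable R : rcfType.
Implicit Types p q : {poly R}.

Definition quad_poly (a b : R) : {poly R} := ('X - a%:P) ^+ 2 + (b ^+ 2)%:P.

(** A root [a + i b] of [p] in the complex closure gives the factor. For [b != 0] the remainder
    modulo [quad_poly a b] is affine and vanishes at that root: the imaginary part kills its slope,
    then the real part its constant. *)
Lemma rcf_linear_or_quadratic_factor p : (1 < size p)%N ->
  (exists a q, p = q * ('X - a%:P)) \/
  (exists a b q, b != 0 /\ p = q * quad_poly a b).
Proof.
move=> p_gt1.
have /closed_rootP[[a b] /eqP zr] : size (map_poly (real_complex R) p) != 1%N.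
  by rewrite size_map_poly; case: ltngtP p_gt1.
have [b0|b0] := eqVneq b 0.
  left; exists a.
  have /factor_theorem[q pE] : root p a.
    rewrite b0 -[_ +i* 0]/(real_complex R a) horner_map /= in zr.
    by case: zr => /eqP.
  by exists q.
right; exists a, b.
have qm : quad_poly a b \is monic.
  rewrite monicE /quad_poly lead_coefDl ?lead_coef_exp ?lead_coefXsubC ?expr1n //.
  by rewrite size_exp_XsubC size_polyC; case: (_ == _).
have qs : size (quad_poly a b) = 3%N.
  by rewrite /quad_poly size_polyDl size_exp_XsubC // size_polyC; case: (_ == _).
exists (p %/ quad_poly a b); split=> //.
have pE : p = p %/ quad_poly a b * quad_poly a b + p %% quad_poly a b.
  exact: Pdiv.IdomainMonic.divp_eq.
rewrite {1}pE.
suff -> : p %% quad_poly a b = 0 by rewrite addr0.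
set r := _ %% _.
have rs : (size r <= 2)%N.
  by rewrite -ltnS -qs ltn_modp monic_neq0.
have rE : r = (r`_0)%:P + r`_1 *: 'X.
  apply/polyP => i; rewrite coefD coefC coefZ coefX.
  case: i => [|[|i]] /=; rewrite ?mulr0 ?mulr1 ?addr0 ?add0r //.
  by rewrite nth_default // (leq_trans rs).
have qz : (map_poly (real_complex R) (quad_poly a b)).[a +i* b] = 0.
  rewrite /quad_poly rmorphD rmorphXn rmorphB /= map_polyX !map_polyC /=.
  rewrite !hornerE /=; apply/eqP; rewrite eq_complex /=.
  by apply/andP; split; apply/eqP; simpc; rewrite /=; ring.
move: zr; rewrite pE rmorphD rmorphM /= hornerD hornerM qz mulr0 add0r -/r rE.
rewrite rmorphD /= map_polyZ map_polyC map_polyX /= !hornerE /=.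
move=> /eqP; rewrite eq_complex /= => /andP[/eqP re /eqP im].
have r1 : r`_1 = 0.
  apply: (mulIf b0); move: im; simpc; rewrite /=; lra.
have r0 : r`_0 = 0.
  by move: re; rewrite r1; simpc.
by rewrite r0 r1 scale0r addr0.
Qed.
End RealRoots.

(** * Polynomials of an operator *)

Section OperatorPolynomials.
Variables (R : fieldType) (V : vectType R) (P : 'End(V)).
Implicit Types (p q : {poly R}) (C : 'End(V)).

Definition lfun_commute (C D : 'End(V)) := (C \o D = D \o C)%VF.

Definition lfun_horner p : 'End(V) :=
  \sum_(i < size p) p`_i *: iter i (comp_lfun P) \1%VF.

Lemma lfun_horner_wide m p : (size p <= m)%N ->
  lfun_horner p = \sum_(i < m) p`_i *: iter i (comp_lfun P) \1%VF.
Proof.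
move=> pm; rewrite /lfun_horner.
rewrite (big_ord_widen _ (fun i => p`_i *: iter i (comp_lfun P) \1%VF) pm).
rewrite big_mkcond; apply: eq_bigr => i _ /=; case: ltnP => // pi.
by rewrite nth_default // scale0r.
Qed.

Fact lfun_horner_is_linear : linear lfun_horner.
Proof.
move=> c p q; pose m := maxn (size (c *: p + q)) (maxn (size p) (size q)).
rewrite (@lfun_horner_wide m p) ?(@lfun_horner_wide m q)
  ?(@lfun_horner_wide m (_ + _)) /m ?leq_max ?leqnn ?orbT //.
rewrite scaler_sumr -big_split; apply: eq_bigr => i _ /=.
by rewrite coefD coefZ scalerDl scalerA.
Qed.
HB.instance Definition _ := GRing.isLinear.Build R {poly R} 'End(V) *:%R
  lfun_horner lfun_horner_is_linear.

Lemma lfun_hornerC c : lfun_horner c%:P = c *: \1%VF.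
Proof.
rewrite (@lfun_horner_wide 1) ?size_polyC_leq1 //.
by rewrite big_ord1 coefC.
Qed.

Lemma lfun_hornerMX p : lfun_horner (p * 'X) = (lfun_horner p \o P)%VF.
Proof.
have iterC i : iter i.+1 (comp_lfun P) \1%VF = (iter i (comp_lfun P) \1 \o P)%VF.
  elim: i => [|i IH]; first by rewrite /= comp_lfun1l comp_lfun1r.
  by rewrite [LHS]iterS {1}IH comp_lfunA.
rewrite (@lfun_horner_wide (size p).+1); last first.
  by rewrite (leq_trans (size_polyMleq _ _)) // size_polyX addnC.
rewrite big_ord_recl coefMX /= scale0r add0r /lfun_horner.
apply/lfunP => w; rewrite comp_lfunE !sum_lfunE; apply: eq_bigr => i _.
rewrite !scale_lfunE coefMX /= -comp_lfunE -(iterC i).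
by [].
Qed.

Lemma lfun_hornerM p q :
  lfun_horner (p * q) = (lfun_horner p \o lfun_horner q)%VF.
Proof.
elim/poly_ind: q => [|q c IH]; first by rewrite mulr0 linear0 comp_lfun0r.
rewrite mulrDr mulrA !linearD /= !lfun_hornerMX IH comp_lfunDr comp_lfunA.
by rewrite mulrC mul_polyC linearZ /= lfun_hornerC -comp_lfunZr comp_lfun1r.
Qed.

Lemma lfun_hornerX : lfun_horner 'X = P.
Proof. by rewrite -['X]mul1r lfun_hornerMX lfun_hornerC scale1r comp_lfun1l. Qed.

Lemma lfun_horner_commute C p :
  lfun_commute C P -> lfun_commute C (lfun_horner p).
Proof.
move=> CP; rewrite /lfun_commute; elim/poly_ind: p => [|p c IH].
  by rewrite linear0 comp_lfun0l comp_lfun0r.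
rewrite linearD /= lfun_hornerMX lfun_hornerC comp_lfunDl comp_lfunDr.
rewrite comp_lfunA IH -!comp_lfunA CP.
by rewrite -comp_lfunZl -comp_lfunZr comp_lfun1l comp_lfun1r.
Qed.

(** In dimension [d], the first [d + 1] powers of [P] are dependent; the coefficients of a
    dependence form [p]. *)
Lemma lfun_horner_annihilated : exists2 p, p != 0 & lfun_horner p = 0.
Proof.
pose d := dim 'End(V).
pose X := [tuple iter (i : nat) (comp_lfun P) \1%VF | i < d.+1].
have : ~~ free X.
  apply/negP; rewrite /free => /eqP dX.
  have := dimvS (subvf <<X>>%VS); rewrite dX size_tuple dimvf -/d.
  by rewrite ltnn.
move/freeP => nfree.
have [k [k0 [i ki]]] : exists k : 'I_d.+1 -> R,
    \sum_(i < d.+1) k i *: X`_i = 0 /\ exists i, k i != 0.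
  apply: contrapT => nex; apply: nfree => k k0 i.
  by apply: contrapT => /eqP ki; apply: nex; exists k; split => //; exists i.
pose p := \poly_(j < d.+1) k (inord j).
have pE (j : 'I_d.+1) : p`_j = k j by rewrite coef_poly ltn_ord inord_val.
exists p; first by apply: contraNneq ki => p0; rewrite -pE p0 coef0.
rewrite (@lfun_horner_wide d.+1) ?size_poly // -[RHS]k0.
by apply: eq_bigr => j _; rewrite pE -tnth_nth tnth_mktuple.
Qed.

End OperatorPolynomials.

(** Newton's scheme: the product over the old nodes vanishes at them and not at the new node [a], so
    a multiple of it corrects the value there. *)
Lemma exists_interpolation (F : fieldType) (phi : F -> F) (s : seq F) :
  uniq s -> exists r : {poly F}, forall a, a \in s -> r.[a] = phi a.
Proof.
elim: s => [|a s IH] /= => [|/andP[sa us]]; first by exists 0.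
have [r rs] := IH us; pose p := \prod_(b <- s) ('X - b%:P).
have pa : p.[a] != 0 by rewrite -[_ == 0]/(root p a) root_prod_XsubC.
exists (r + ((phi a - r.[a]) / p.[a]) *: p) => b.
rewrite !hornerE inE => /predU1P[->|sb]; first by rewrite divfK // addrC subrK.
have /rootP -> : root p b by rewrite root_prod_XsubC.
by rewrite mulr0 addr0 rs.
Qed.

(** * Positive operators and their square roots *)

Section EuclideanOperators.
Variables (R : rcfType) (V : vectType R) (ip : V -> V -> R).

Definition inner_product :=
  [/\ forall c u v w, ip (c *: u + v) w = c * ip u w + ip v w,
      forall v w, ip v w = ip w v & forall v, v != 0 -> 0 < ip v v].

Definition symmetric_op (C : 'End(V)) := forall v w, ip (C v) w = ip v (C w).
Definition psd_op (C : 'End(V)) :=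
  symmetric_op C /\ forall w, 0 <= ip (C w) w.

Hypothesis ip_ok : inner_product.
Implicit Types (C D P S : 'End(V)) (u v w : V).

Lemma ip_sym v w : ip v w = ip w v. Proof. by case: ip_ok. Qed.
Lemma ipDl u v w : ip (u + v) w = ip u w + ip v w.
Proof. by case: ip_ok => lin _ _; rewrite -[u]scale1r lin scale1r mul1r. Qed.
Lemma ip0l w : ip 0 w = 0.
Proof. by have := ipDl 0 0 w; rewrite addr0; lra. Qed.
Lemma ipZl c v w : ip (c *: v) w = c * ip v w.
Proof. by case: ip_ok => lin _ _; rewrite -[c *: v]addr0 lin ip0l addr0. Qed.
Lemma ipNl v w : ip (- v) w = - ip v w.
Proof. by rewrite -scaleN1r ipZl mulN1r. Qed.
Lemma ipDr u v w : ip w (u + v) = ip w u + ip w v.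
Proof. by rewrite ip_sym ipDl !(ip_sym w). Qed.
Lemma ip0r w : ip w 0 = 0. Proof. by rewrite ip_sym ip0l. Qed.
Lemma ipZr c v w : ip w (c *: v) = c * ip w v.
Proof. by rewrite ip_sym ipZl ip_sym. Qed.
Lemma ipNr v w : ip w (- v) = - ip w v.
Proof. by rewrite ip_sym ipNl ip_sym. Qed.
Definition ipE := (ipDl, ipDr, ipZl, ipZr, ipNl, ipNr).

Lemma ip_ge0 v : 0 <= ip v v.
Proof.
have [->|v0] := eqVneq v 0; first by rewrite ip0l.
by apply: ltW; case: ip_ok => _ _; apply.
Qed.
Lemma ip_eq0 v : ip v v = 0 -> v = 0.
Proof.
move=> v0; apply: contrapT => /eqP nv; case: ip_ok => _ _ /(_ v nv).
by rewrite v0 ltxx.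
Qed.

Lemma symmetric_op1 : symmetric_op \1%VF.
Proof. by move=> v w; rewrite !lfunE. Qed.
Lemma symmetric_opD C D :
  symmetric_op C -> symmetric_op D -> symmetric_op (C + D).
Proof. by move=> sC sD v w; rewrite !add_lfunE !ipE sC sD. Qed.
Lemma symmetric_opZ c C : symmetric_op C -> symmetric_op (c *: C).
Proof. by move=> sC v w; rewrite !scale_lfunE !ipE sC. Qed.
Lemma symmetric_op_comp C D : lfun_commute C D ->
  symmetric_op C -> symmetric_op D -> symmetric_op (C \o D)%VF.
Proof. by move=> CD sC sD v w; rewrite {2}CD !comp_lfunE sC sD. Qed.
Lemma symmetric_horner P p : symmetric_op P -> symmetric_op (lfun_horner P p).
Proof.
move=> sP; elim/poly_ind: p => [|p c IH].
  by move=> v w; rewrite linear0 !zero_lfunE ip0l ip0r.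
rewrite linearD /= lfun_hornerMX lfun_hornerC; apply: symmetric_opD.
  by apply: symmetric_op_comp => //; apply/esym/lfun_horner_commute.
exact/symmetric_opZ/symmetric_op1.
Qed.

Lemma symmetric_op_sqr_eq0 P w : symmetric_op P -> P (P w) = 0 -> P w = 0.
Proof. by move=> sP PP0; apply: ip_eq0; rewrite sP PP0 ip0r. Qed.

(** Induction on the size of [p]. The right factor [D] is arbitrary so that a linear factor with a
    nonnegative root can be moved into it; every other factor takes an injective value at [P] and is
    dropped. *)
Lemma psd_op_split_horner P D p : psd_op P -> p != 0 ->
  (lfun_horner P p \o D = 0)%VF -> exists2 s, uniq s && all (>= 0) s &
  (lfun_horner P (\prod_(a <- s) ('X - a%:P)) \o D = 0)%VF.
Proof.
move=> [sP P_ge0]; have [m] := ubnP (size p); elim: m p D => // m IH p D pm p0 pD.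
have [p1|p1] := leqP (size p) 1.
  move: pD; rewrite (size1_polyC p1) lfun_hornerC -comp_lfunZl comp_lfun1l => /eqP.
  have p00 : p`_0 != 0 by apply: contraNneq p0 => p00; rewrite (size1_polyC p1) p00.
  rewrite scaler_eq0 (negPf p00) /= => /eqP ->; exists [::] => //.
  by rewrite comp_lfun0r.
case: (rcf_linear_or_quadratic_factor p1) => [[a [q pE]]|[a [b [q [b0 pE]]]]];
    have q0 : q != 0 by apply: contraNneq p0 => q0; rewrite pE q0 mul0r.
  have qm : (size q < m)%N.
    rewrite -ltnS (leq_trans _ pm) // pE size_Mmonic ?monicXsubC //.
    by rewrite size_XsubC addnC.
  (* For [a < 0], [P u = a *: u] forces [u = 0], because [ip (P u) u] is nonnegative. *)
  have [a_lt0|a_ge0] := ltP a 0.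
    apply: (IH q _ qm q0).
    apply/lfunP => w; have := congr1 (fun C : 'End(V) => C w) pD.
    rewrite pE mulrC lfun_hornerM !comp_lfunE !zero_lfunE.
    set u := lfun_horner P q _ => qu; apply: ip_eq0.
    have : ip (lfun_horner P ('X - a%:P) u) u = 0 by rewrite qu ip0l.
    rewrite linearB /= lfun_hornerX lfun_hornerC.
    rewrite add_lfunE opp_lfunE scale_lfunE lfunE !ipE.
    have := P_ge0 u; have := ip_ge0 u; nra.
  have [|s /andP[us s_ge0] sD] := IH q (lfun_horner P ('X - a%:P) \o D)%VF qm q0.
    by rewrite comp_lfunA -lfun_hornerM -pE.
  (* If [a] is already in [s], the square of [P - a] annihilates; by symmetry it has the same kernel
     as [P - a], so [s] stays free of repetitions. *)
  have [sa|sa] := boolP (a \in s); last first.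
    exists (a :: s); first by rewrite /= sa us a_ge0.
    by rewrite big_cons mulrC lfun_hornerM -comp_lfunA.
  exists s; first by rewrite us.
  move: sD.
  rewrite (big_rem a sa) /= comp_lfunA -lfun_hornerM -mulrA.
  rewrite [_ * ('X - _)]mulrC mulrA !lfun_hornerM => sD.
  apply/lfunP => w; have := congr1 (fun C : 'End(V) => C w) sD.
  rewrite !comp_lfunE !zero_lfunE; apply: symmetric_op_sqr_eq0.
  exact: symmetric_horner.
apply: (IH q _ _ q0).
  rewrite -ltnS (leq_trans _ pm) // pE /quad_poly.
  have sb : (size ((b ^+ 2)%:P : {poly R}) < size (('X - a%:P) ^+ 2))%N.
    by rewrite size_exp_XsubC size_polyC; case: (_ == _).
  have qm : ('X - a%:P) ^+ 2 + (b ^+ 2)%:P \is monic.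
    by rewrite monicE lead_coefDl // -monicE monic_exp // monicXsubC.
  by rewrite size_Mmonic // size_polyDl // size_exp_XsubC addnC.
apply/lfunP => w; have := congr1 (fun C : 'End(V) => C w) pD.
rewrite pE mulrC lfun_hornerM !comp_lfunE !zero_lfunE.
set u := lfun_horner P q _ => qu; apply: ip_eq0.
(* With [t = (P - a) u] this reads [ip t t + b ^+ 2 * ip u u = 0], hence [u = 0]. *)
have : ip (lfun_horner P (quad_poly a b) u) u = 0 by rewrite qu ip0l.
rewrite /quad_poly linearD /= expr2 lfun_hornerM lfun_hornerC.
rewrite add_lfunE comp_lfunE scale_lfunE lfunE ipDl ipZl.
rewrite symmetric_horner //.
set t := lfun_horner P _ u.
have := ip_ge0 t; have := ip_ge0 u.
have : 0 < b ^+ 2 by rewrite exprn_even_gt0.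
nra.
Qed.

Lemma psd_op_sqrt P : psd_op P -> exists S,
  [/\ psd_op S, (S \o S)%VF = P & forall C, lfun_commute C P -> lfun_commute C S].
Proof.
move=> psdP; have [p p0 pP] := lfun_horner_annihilated P.
have [|s /andP[us s_ge0]] := @psd_op_split_horner P \1%VF p psdP p0.
  by rewrite pP comp_lfun0l.
rewrite comp_lfun1r; set pi := \prod_(a <- s) _ => piP.
(* r interpolates the fourth root on the spectrum, so that the square root
   r ^ 2 of P is itself a square, hence positive *)
have [r rs] := exists_interpolation (fun a => Num.sqrt (Num.sqrt a)) us.
have [sP _] := psdP.
(* The fourth power of [r] agrees with ['X] at the simple roots of [pi], so [pi] divides the
   difference, which therefore vanishes at [P]. *)
have /dvdpP[q qE] : pi %| r ^+ 2 * r ^+ 2 - 'X.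
  apply: uniq_roots_dvdp; last by rewrite uniq_rootsE.
  apply/allP => a sa; rewrite /root hornerD hornerN hornerX hornerM horner_exp.
  rewrite rs // sqr_sqrtr ?sqrtr_ge0 //.
  have a_ge0 := allP s_ge0 a sa.
  by rewrite -expr2 sqr_sqrtr // subrr.
exists (lfun_horner P (r ^+ 2)); split.
- split; first exact: symmetric_horner.
  move=> w; rewrite expr2 lfun_hornerM comp_lfunE symmetric_horner //.
  exact: ip_ge0.
- rewrite -lfun_hornerM -[_ * _](subrK 'X) qE linearD /= lfun_hornerX.
  by rewrite lfun_hornerM piP comp_lfun0r add0r.
- by move=> C; apply: lfun_horner_commute.
Qed.

(** With [S] the root of [D], which commutes with [C], the form of [C \o D] at [w] is the form of
    [C] at [S w]. *)
Lemma psd_op_comp C D : lfun_commute C D ->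
  psd_op C -> psd_op D -> psd_op (C \o D)%VF.
Proof.
move=> CD [sC C_ge0] psdD; split.
  by case: psdD => sD _; apply: symmetric_op_comp.
have [S [[sS _] SE /(_ C CD) CS]] := psd_op_sqrt psdD.
by move=> w; rewrite -SE comp_lfunA CS !comp_lfunE sS.
Qed.

(** The form at [w] is the squared norm of [S w], with [S] the root of [C]. *)
Lemma psd_op_kernel C w : psd_op C -> ip (C w) w = 0 -> C w = 0.
Proof.
move=> psdC; have [S [[sS _] SE _]] := psd_op_sqrt psdC.
by rewrite -SE comp_lfunE sS => /ip_eq0 ->; rewrite linear0.
Qed.

Lemma psd_op_Cauchy_Schwarz C v w : psd_op C ->
  ip (C v) w <= Num.sqrt (ip (C v) v) * Num.sqrt (ip (C w) w).
Proof.
move=> psdC; have [sC C_ge0] := psdC; rewrite -sqrtrM ?C_ge0 //.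
apply: le_trans (ler_norm _) _; rewrite -sqrtr_sqr; apply: ler_wsqrtr.
have [v0|v0] := eqVneq (ip (C v) v) 0.
  by rewrite (psd_op_kernel psdC v0) !ip0l expr0n mul0r.
have v_gt0 : 0 < ip (C v) v by rewrite lt_def v0 C_ge0.
(* At this vector the form equals [ip (C v) v] times the difference of the two sides of the goal. *)
have := C_ge0 (- ip (C v) w *: v + ip (C v) v *: w).
rewrite linearD !linearZ /= !ipE (sC w v) (ip_sym w) => quad.
rewrite -(ler_pM2l v_gt0); lra.
Qed.

End EuclideanOperators.

(** * The three-level scheme *)

(** Lagrange's identity: the squares of the two sides differ by [(x1 * y2 - x2 * y1) ^+ 2]. *)
Lemma Cauchy_Schwarz2 (R : rcfType) (x1 x2 y1 y2 : R) : x1 * y1 + x2 * y2 <=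
  Num.sqrt (x1 ^+ 2 + x2 ^+ 2) * Num.sqrt (y1 ^+ 2 + y2 ^+ 2).
Proof.
rewrite -sqrtrM ?addr_ge0 ?sqr_ge0 //; apply: le_trans (ler_norm _) _.
rewrite -sqrtr_sqr; apply: ler_wsqrtr; have := sqr_ge0 (x1 * y2 - x2 * y1); lra.
Qed.

Lemma Iht_recr (R : realType) (ht : R) m (y : nat -> R) :
  Iht ht m.+1 y = Iht ht m y + ht * y m.+1.
Proof. by rewrite /Iht big_nat_recr //= mulrDr. Qed.

Section ThreeLevelScheme.
Variables (R : realType) (V : vectType R) (ip : V -> V -> R).
Hypothesis ip_ok : inner_product ip.
Let ip_sym := ip_sym ip_ok.
Let ipE := ipE ip_ok.
Variables (sb At : 'End(V)) (ht : R) (M : nat) (v g : nat -> V) (u1 : V).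
Hypotheses (sb_psd : psd_op ip sb) (At_psd : psd_op ip At) (ht_gt0 : 0 < ht).
Hypothesis v_step : forall m, (1 <= m <= M.-1)%N ->
  sb (Lambda_t ht v m) + At (v m) = sb (g m).
Hypothesis v_start : sb (dt ht v 0) =
  - (ht / 2) *: At (v 0%N) + sb u1 + (ht / 2) *: sb (g 0%N).

Let At_sym x y : ip (At x) y = ip (At y) x.
Proof. by case: At_psd => sA _; rewrite sA ip_sym. Qed.
Let sb_sym x y : ip (sb x) y = ip (sb y) x.
Proof. by case: sb_psd => sS _; rewrite sS ip_sym. Qed.

Definition energy m :=
  ip (sb (dt_bar ht v m)) (dt_bar ht v m)
  - ht ^+ 2 / 4 * ip (At (dt_bar ht v m)) (dt_bar ht v m)
  + ip (At (st_bar v m)) (st_bar v m).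

(** By polarization the two [At] terms merge into a product of consecutive levels, the form that
    telescopes. *)
Lemma energyE m : energy m =
  ip (sb (v m - v m.-1)) (v m - v m.-1) / ht ^+ 2 + ip (At (v m.-1)) (v m).
Proof.
rewrite /energy /dt_bar /st_bar !(linearD, linearN, linearZ) /= !ipE.
rewrite [ip (At (v m)) (v m.-1)]At_sym.
field; exact: lt0r_neq0.
Qed.

(** Pairing the scheme with [v m.+1 - v m.-1], which is [2 * ht] times the central difference, makes
    both the [sb] term and the [At] term differences of their values at consecutive levels. *)
Lemma energy_step m : (1 <= m <= M.-1)%N ->
  energy m.+1 = energy m + 2 * (ht * ip (sb (g m)) (dt_ring ht v m)).
Proof.
move=> /v_step <-; rewrite !energyE /= /Lambda_t /dt_ring.
rewrite !(linearD, linearN, linearZ) /= !ipE.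
rewrite [ip (At (v m)) (v m.-1)]At_sym [ip (sb (v m)) (v m.-1)]sb_sym.
rewrite [ip (sb (v m.+1)) (v m.-1)]sb_sym [ip (sb (v m.+1)) (v m)]sb_sym.
field; exact: lt0r_neq0.
Qed.

Lemma energy_conservation m : (1 <= m <= M)%N ->
  energy m = ip (At (v 0%N)) (st v 0) + ip (sb u1) (dt ht v 0)
      + ht / 2 * ip (sb (g 0%N)) (dt ht v 0)
      + 2 * Iht ht m.-1 (fun l => ip (sb (g l)) (dt_ring ht v l)).
Proof.
case: m => // m /=; elim: m => [_|m IH mM].
  rewrite /Iht big_geq // energyE /= -/(dt_bar ht v 1).
  (* The [At] term of the start equation, added to [ip (At (v 0)) (v 1)] from the energy at level 1,
     leaves the pairing with the average [st v 0]. *)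
  have := congr1 (fun w => ip w (dt ht v 0)) v_start.
  rewrite /= !(ipDl ip_ok) !(ipZl ip_ok) /dt /st.
  rewrite !(linearD, linearN, linearZ) /= !ipE => start.
  have ht0 : ht != 0 by exact: lt0r_neq0.
  transitivity (ht^-1 * (ht^-1 * ip (sb (v 1)) (v 1) + ht^-1 * - ip (sb (v 0)) (v 1))
    + ht^-1 * (ht^-1 * - ip (sb (v 1)) (v 0) + ht^-1 * - - ip (sb (v 0)) (v 0))
    + ip (At (v 0)) (v 1)); first by field.
  by rewrite start; field.
rewrite energy_step; last by case: (M) mM.
by rewrite IH ?(ltnW mM) // Iht_recr mulrDr addrA.
Qed.

(** * The stability bound *)

Section Stability.
Variable eps0 : R.
Hypotheses (eps0_gt0 : 0 < eps0) (M_gt0 : (0 < M)%N).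
Hypothesis CFL : forall w,
  ht ^+ 2 / 4 * ip (At w) w <= (1 - eps0 ^+ 2) * ip (sb w) w.

Local Notation norm_sb w := (Num.sqrt (ip (sb w) w)).
Local Notation norm_At w := (Num.sqrt (ip (At w) w)).

Definition weak_energy m :=
  eps0 ^+ 2 * ip (sb (dt_bar ht v m)) (dt_bar ht v m)
  + ip (At (st_bar v m)) (st_bar v m).

(** [CFL] absorbs the negative [At] term and leaves the share [eps0 ^+ 2] of the [sb] term. *)
Lemma weak_energy_le m : weak_energy m <= energy m.
Proof. by rewrite /weak_energy /energy; have := CFL (dt_bar ht v m); lra. Qed.

Lemma stability_bound :
  \big[Num.max/0]_(1 <= m < M.+1) Num.sqrt (weak_energy m)
  <= Num.sqrt (ip (At (v 0%N)) (v 0%N) + eps0 ^- 2 * ip (sb u1) u1)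
   + 2 / eps0 * (ht / 4 * norm_sb (g 0%N) + Iht ht M.-1 (fun l => norm_sb (g l))).
Proof.
set Q := \big[_/_]_(_ <= _ < _) _; set K := Num.sqrt (_ + _).
set B := K + _.
have [_ At_ge0] := At_psd; have [_ sb_ge0] := sb_psd.
have Q_ge m : (1 <= m <= M)%N -> Num.sqrt (weak_energy m) <= Q.
  by move=> mM; apply: (@le_bigmax_seq _ _ _ (index_iota 1 M.+1) _ m xpredT
    (fun m => Num.sqrt (weak_energy m))); rewrite // mem_index_iota.
have Q_ge0 : 0 <= Q by apply: le_trans (Q_ge 1 _); rewrite ?sqrtr_ge0.
have dt_le m : (1 <= m <= M)%N -> norm_sb (dt_bar ht v m) <= Q / eps0.
  move=> mM; rewrite ler_pdivlMr //; apply: le_trans (Q_ge _ mM).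
  rewrite -[leLHS]ger0_norm ?mulr_ge0 ?sqrtr_ge0 ?(ltW eps0_gt0) //.
  rewrite -sqrtr_sqr exprMn sqr_sqrtr //; apply: ler_wsqrtr.
  by rewrite /weak_energy mulrC lerDl.
(* [G m] is the norm of the data up to level [m]; being nondecreasing, it is bounded by [G M.-1] at
   all levels used. *)
pose G m := ht / 4 * norm_sb (g 0%N) + Iht ht m (fun l => norm_sb (g l)).
have G_mono m k : G m <= G (m + k)%N.
  elim: k => [|k IH]; rewrite ?addn0 // addnS; apply: le_trans IH _.
  rewrite /G Iht_recr addrA lerDl.
  by rewrite mulr_ge0 ?sqrtr_ge0 // ltW.
have G_ge0 : 0 <= G M.-1.
  apply: le_trans (G_mono 0%N M.-1); rewrite /G /Iht big_geq // mulr0 addr0.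
  by rewrite mulr_ge0 ?sqrtr_ge0 // divr_ge0 ?ltW.
have B_ge0 : 0 <= B.
  rewrite addr_ge0 ?sqrtr_ge0 // mulr_ge0 // divr_ge0 //; exact: ltW.
have ring_le m : (1 <= m <= M.-1)%N ->
    ip (sb (g m)) (dt_ring ht v m) <= norm_sb (g m) * (Q / eps0).
  move=> mM.
  (* The central difference is the mean of two backward differences, each of norm at most
     [Q / eps0]. *)
  have -> : dt_ring ht v m = 2^-1 *: dt_bar ht v m + 2^-1 *: dt_bar ht v m.+1.
    rewrite /dt_ring /dt_bar /= -scalerDr -scalerDr scalerA invfM mulrC.
    by congr (_ *: _); rewrite [RHS]addrC addrA subrK.
  have := psd_op_Cauchy_Schwarz ip_ok (g m) (dt_bar ht v m) sb_psd.
  have := psd_op_Cauchy_Schwarz ip_ok (g m) (dt_bar ht v m.+1) sb_psd.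
  have dm : norm_sb (dt_bar ht v m) <= Q / eps0.
    by apply: dt_le; case/andP: mM => -> /leq_trans; apply; exact: leq_pred.
  have dm1 : norm_sb (dt_bar ht v m.+1) <= Q / eps0.
    by apply: dt_le; case/andP: mM => _ /=; rewrite -ltnS prednK.
  have := ler_wpM2l (sqrtr_ge0 (ip (sb (g m)) (g m))) dm.
  have := ler_wpM2l (sqrtr_ge0 (ip (sb (g m)) (g m))) dm1.
  rewrite !ipE; lra.
have M1 : (1 <= 1 <= M)%N by [].
have init_le : ip (At (v 0%N)) (st v 0) + ip (sb u1) (dt ht v 0) <= K * Q.
  have := psd_op_Cauchy_Schwarz ip_ok (v 0%N) (st v 0) At_psd.
  have := psd_op_Cauchy_Schwarz ip_ok u1 (dt ht v 0) sb_psd.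
  (* The weights cancel in the pairing, and the second pair has norm the root of [weak_energy 1]:
     [dt ht v 0] and [st v 0] are [dt_bar ht v 1] and [st_bar v 1]. *)
  have := Cauchy_Schwarz2 (norm_At (v 0%N)) (eps0^-1 * norm_sb u1)
    (norm_At (st v 0)) (eps0 * norm_sb (dt ht v 0)).
  rewrite !exprMn !sqr_sqrtr // exprVn -/K [X in _ * Num.sqrt X]addrC.
  have := ler_wpM2l (sqrtr_ge0 _ : 0 <= K) (Q_ge 1 M1).
  have -> : eps0^-1 * norm_sb u1 * (eps0 * norm_sb (dt ht v 0)) =
    norm_sb u1 * norm_sb (dt ht v 0) by field; exact: lt0r_neq0.
  rewrite /weak_energy /=; lra.
have energy_le m : (m < M)%N -> energy m.+1 <= K * Q + 2 / eps0 * G m * Q.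
  move=> mM; rewrite energy_conservation //=.
  have := psd_op_Cauchy_Schwarz ip_ok (g 0%N) (dt ht v 0) sb_psd.
  have := ler_wpM2l (sqrtr_ge0 (ip (sb (g 0%N)) (g 0%N))) (dt_le 1 M1).
  rewrite -/(dt ht v 0) => g0Q g0.
  have {}g0 := ler_wpM2l (ltW ht_gt0) (le_trans g0 g0Q).
  have : Iht ht m (fun l => ip (sb (g l)) (dt_ring ht v l)) <=
      Iht ht m (fun l => norm_sb (g l)) * (Q / eps0).
    rewrite /Iht -mulrA ler_wpM2l ?(ltW ht_gt0) // mulr_suml.
    rewrite big_nat_cond [leRHS]big_nat_cond; apply: ler_sum => l.
    rewrite andbT => /andP[l_gt0 lm]; apply: ring_le; rewrite l_gt0 -ltnS prednK //.
    exact: leq_trans lm mM.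
  rewrite /G.
  (* The coefficient [ht / 2] of the initial term in the energy law is the origin of the weight
     [ht / 4]. *)
  have -> : 2 / eps0 * (ht / 4 * norm_sb (g 0%N) +
    Iht ht m (fun l => norm_sb (g l))) * Q = ht * (norm_sb (g 0%N) * (Q / eps0)) / 2
    + 2 * (Iht ht m (fun l => norm_sb (g l)) * (Q / eps0)) by field; exact: lt0r_neq0.
  lra.
have weak_le m : (1 <= m <= M)%N -> weak_energy m <= B * Q.
  case: m => // m mM; apply: le_trans (weak_energy_le _) _.
  apply: le_trans (energy_le _ mM) _; rewrite -mulrDl ler_wpM2r // lerD2l.
  apply: ler_wpM2l; first by rewrite divr_ge0 // ltW.
  have mM1 : (m <= M.-1)%N by rewrite -ltnS prednK.
  by have := G_mono m (M.-1 - m)%N; rewrite (subnKC mM1).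
(* The root also dominates the default value 0 of the maximum. Squaring and cancelling [Q], unless
   it is 0, finishes. *)
have : Q <= Num.sqrt (B * Q).
  rewrite [leLHS]big_nat_cond; apply: bigmax_le => [|m]; first exact: sqrtr_ge0.
  by rewrite andbT ltnS => mM; apply/ler_wsqrtr/weak_le.
have [->|Q0] := eqVneq Q 0; first by [].
have Q_gt0 : 0 < Q by rewrite lt_def Q0.
rewrite -ler_sqr ?nnegrE ?sqrtr_ge0 // sqr_sqrtr ?mulr_ge0 // expr2.
by rewrite ler_pM2r.
Qed.

End Stability.

End ThreeLevelScheme.

(** * Commuting operators *)

Section CommutingOperators.
Variables (R : fieldType) (V : vectType R).
Implicit Types C D : 'End(V).

Lemma lfun_commute_sym C D : lfun_commute C D -> lfun_commute D C.
Proof. exact: esym. Qed.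

Lemma lfun_commute1 C : lfun_commute C \1%VF.
Proof. by rewrite /lfun_commute comp_lfun1l comp_lfun1r. Qed.

Lemma lfun_commuteD C D1 D2 :
  lfun_commute C D1 -> lfun_commute C D2 -> lfun_commute C (D1 + D2).
Proof. by rewrite /lfun_commute comp_lfunDl comp_lfunDr => -> ->. Qed.

Lemma lfun_commuteZ c C D : lfun_commute C D -> lfun_commute C (c *: D).
Proof. by rewrite /lfun_commute -comp_lfunZl -comp_lfunZr => ->. Qed.

Lemma lfun_commuteN C D : lfun_commute C D -> lfun_commute C (- D).
Proof. by rewrite -scaleN1r; exact: lfun_commuteZ. Qed.

Lemma lfun_commute_sum I (r : seq I) C (D : I -> 'End(V)) :
  (forall i, lfun_commute C (D i)) -> lfun_commute C (\sum_(i <- r) D i).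
Proof.
move=> CD; elim/big_ind: _ => // [|D1 D2]; last exact: lfun_commuteD.
by rewrite /lfun_commute comp_lfun0l comp_lfun0r.
Qed.

Lemma lfun_commute_comp C D1 D2 :
  lfun_commute C D1 -> lfun_commute C D2 -> lfun_commute C (D1 \o D2)%VF.
Proof.
by rewrite /lfun_commute => CD1 CD2; rewrite comp_lfunA CD1 -!comp_lfunA CD2.
Qed.

Lemma lfun_commute_big I (r : seq I) (P : pred I) C (D : I -> 'End(V)) :
  (forall i, lfun_commute C (D i)) ->
  lfun_commute C (\big[@comp_lfun _ _ _ _ / \1]_(i <- r | P i) D i)%VF.
Proof.
move=> CD; elim/big_ind: _ => // [|D1 D2]; last exact: lfun_commute_comp.
exact: lfun_commute1.
Qed.

Lemma lfun_commute_inv C D : lker D == 0%VS ->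
  lfun_commute C D -> lfun_commute C (D^-1)%VF.
Proof.
move=> D0 CD; rewrite /lfun_commute -[LHS]comp_lfun1l -(lker0_compVf D0) -comp_lfunA.
by congr (_ \o _)%VF; rewrite comp_lfunA -CD -comp_lfunA lker0_compfV ?comp_lfun1r.
Qed.

(** Commutation moves [D k] to the right end of the ordered composition; [uniq] makes [k] occur only
    once. *)
Lemma big_comp_lfunD1 (I : eqType) (r : seq I) (D : I -> 'End(V)) k :
  (forall i j, lfun_commute (D i) (D j)) -> uniq r -> k \in r ->
  (\big[@comp_lfun _ _ _ _ / \1]_(i <- r) D i =
   (\big[@comp_lfun _ _ _ _ / \1]_(i <- r | i != k) D i) \o D k)%VF.
Proof.
move=> DC; elim: r => //= i r IH /andP[ir ur]; rewrite inE !big_cons.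
have [-> _|ki kr] /= := eqVneq k i; last by rewrite IH // comp_lfunA.
rewrite (lfun_commute_big _ _ (DC i)) [in RHS]big_seq_cond.
rewrite [in LHS]big_seq; congr (_ \o _)%VF; apply: eq_bigl => j.
by have [->|] := eqVneq j i; rewrite ?andbT // (negPf ir).
Qed.

Lemma big_comp_lfun_lker0 I (r : seq I) (D : I -> 'End(V)) :
  (forall i, lker (D i) == 0%VS) ->
  lker (\big[@comp_lfun _ _ _ _ / \1]_(i <- r) D i)%VF == 0%VS.
Proof.
move=> D0; elim: r => [|i r /lker0P IH].
  by rewrite big_nil; apply/lker0P => v w; rewrite !lfunE.
rewrite big_cons; apply/lker0P => v w.
by rewrite !comp_lfunE => /(lker0P (D0 i))/IH.
Qed.

End CommutingOperators.

(** * Sums and products of positive operators *)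

Section PositiveOperators.
Variables (R : rcfType) (V : vectType R) (ip : V -> V -> R).
Hypothesis ip_ok : inner_product ip.
Implicit Types C D : 'End(V).

Lemma psd_opZ c C : 0 <= c -> psd_op ip C -> psd_op ip (c *: C).
Proof.
move=> c0 [sC C0]; split; first exact: symmetric_opZ.
by move=> w; rewrite scale_lfunE (ipZl ip_ok) mulr_ge0.
Qed.

Lemma psd_op_sum I (r : seq I) (D : I -> 'End(V)) :
  (forall i, psd_op ip (D i)) -> psd_op ip (\sum_(i <- r) D i).
Proof.
move=> Dpsd; elim/big_ind: _ => // [|A B [sA A0] [sB B0]].
  by split=> [v w|w]; rewrite !zero_lfunE ?(ip0l ip_ok) ?(ip0r ip_ok).
split; first exact: symmetric_opD.
by move=> w; rewrite add_lfunE (ipDl ip_ok) addr_ge0.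
Qed.

Lemma psd_op_big I (r : seq I) (P : pred I) (D : I -> 'End(V)) :
  (forall i j, lfun_commute (D i) (D j)) -> (forall i, psd_op ip (D i)) ->
  psd_op ip (\big[@comp_lfun _ _ _ _ / \1]_(i <- r | P i) D i)%VF.
Proof.
move=> DC Dpsd; elim: r => [|i r IH].
  rewrite big_nil; split=> [|w]; first exact: symmetric_op1.
  by rewrite lfunE ip_ge0.
rewrite big_cons; case: (P i) => //; apply: psd_op_comp => //.
exact: lfun_commute_big.
Qed.

End PositiveOperators.

(** * Shifts and second differences on the mesh *)

Section MeshFunctions.
Variables (R : realType) (n : nat) (N : 'I_n -> nat) (h : 'I_n -> R).
Hypothesis h_gt0 : forall k, 0 < h k.
Local Notation Hh := (Hh R N).
Local Notation ip := (@ip R n N h).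
Implicit Types (u v w : Hh) (x y : mesh N) (d e : bool).

Lemma HvalD u v x : Hval (u + v) x = Hval u x + Hval v x.
Proof. by rewrite /Hval linearD ffunE. Qed.
Lemma HvalZ c u x : Hval (c *: u) x = c * Hval u x.
Proof. by rewrite /Hval linearZ ffunE. Qed.
Lemma Hval_inj u v : Hval u =1 Hval v -> u = v.
Proof. by move=> uv; apply: val_inj; apply/ffunP. Qed.
Lemma Hval_out u x : x \notin omega N -> Hval u x = 0.
Proof. by move: x; apply/mem_Hspace/subvsP. Qed.

Lemma prod_h_gt0 : 0 < \prod_k h k.
Proof. by apply: prodr_gt0. Qed.

Lemma ip_inner_product : inner_product ip.
Proof.
split=> [c u v w|v w|v].
- rewrite /Defs.ip mulrCA -mulrDr; congr (_ * _).
  rewrite mulr_sumr -big_split /=.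
  by apply: eq_bigr => x _; rewrite HvalD HvalZ; ring.
- by rewrite /Defs.ip; congr (_ * _); apply: eq_bigr => x _; rewrite mulrC.
- move=> v0; rewrite pmulr_rgt0 ?prod_h_gt0 // lt_def.
  rewrite sumr_ge0 ?andbT; last by move=> x _; rewrite -expr2 sqr_ge0.
  apply: contraNneq v0 => /psumr_eq0P v0; apply/eqP/Hval_inj => x.
  rewrite [RHS]ffunE; have [xI|/Hval_out //] := boolP (x \in omega N).
  apply/eqP; rewrite -sqrf_eq0 expr2 v0 // => y _.
  by rewrite -expr2 sqr_ge0.
Qed.
Let ip_ok := ip_inner_product.

(** The Boolean treats both senses of a step at once, with [~~ d] the reverse of [d]. *)
Definition nbr d k x := if d then nbr_next k x else nbr_prev k x.

Lemma nbr_other d k x i : i != k -> nbr d k x i = x i.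
Proof.
by move=> /negPf ik; case: d; rewrite ffunE ik ?addn0 ?subn0 inord_val.
Qed.

Lemma nbr_local d k x y i : x i = y i -> nbr d k x i = nbr d k y i.
Proof. by case: d => /=; rewrite !ffunE => ->. Qed.

Lemma nbrC d e k l x : k != l -> nbr d k (nbr e l x) = nbr e l (nbr d k x).
Proof.
move=> kl; apply/ffunP => i; have [->|ik] := eqVneq i k.
  rewrite [RHS]nbr_other //; apply: nbr_local; exact: nbr_other.
by rewrite [LHS]nbr_other //; apply: nbr_local; rewrite nbr_other.
Qed.

Lemma omegaP x : reflect (forall k, 0 < x k < N k)%N (x \in omega N).
Proof. by rewrite inE; exact: forallP. Qed.

Lemma nbrK d k x : x \in omega N -> nbr (~~ d) k (nbr d k x) = x.
Proof.
move=> /omegaP xI; apply/ffunP => i; have [->|ik] := eqVneq i k; last first.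
  by rewrite !nbr_other.
have /andP[x_gt0 xN] := xI k; apply/val_inj.
have xN1 : (x k < (N k).+1)%N by apply: ltnW.
have next_lt : (x k + 1 < (N k).+1)%N by rewrite addn1.
have prev_lt : (x k - 1 < (N k).+1)%N := leq_ltn_trans (leq_subr _ _) xN1.
by case: d => /=; rewrite !ffunE eqxx /= !inordK ?addnK ?subnK.
Qed.

(** [Lambda] and [sN] are combinations of shifts and the identity, so their symmetry, commutation
    and bounds reduce to those of shifts. *)
Definition shift d k : 'End(Hh) := Hop (fun (f : mesh_fun R N) x => f (nbr d k x)).

Lemma shiftE d k w x :
  Hval (shift d k w) x = if x \in omega N then Hval w (nbr d k x) else 0.
Proof. by rewrite HopE // => c u v y; rewrite !ffunE. Qed.

(** Requiring both ends of the step to lie in [omega] makes the change of variable [y = nbr d k x]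
    bijective. *)
Lemma sum_nbr d k (F : mesh N -> mesh N -> R) :
  \sum_(x in omega N | nbr d k x \in omega N) F x (nbr d k x) =
  \sum_(y in omega N | nbr (~~ d) k y \in omega N) F (nbr (~~ d) k y) y.
Proof.
rewrite (reindex_onto (nbr (~~ d) k) (nbr d k)) /=; last first.
  by move=> x /andP[xI _]; rewrite nbrK.
apply: eq_big => y; last by move=> /andP[_ /eqP ->].
apply/idP/idP => [/andP[/andP[pI nI] /eqP yE]|/andP[yI pI]].
  by rewrite pI andbT -yE.
by have := nbrK (~~ d) k yI; rewrite negbK => ->; rewrite pI yI eqxx.
Qed.

Lemma ip_shiftl d k v w : ip (shift d k v) w =
  (\prod_k h k) *
  \sum_(x in omega N | nbr d k x \in omega N) Hval v (nbr d k x) * Hval w x.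
Proof.
rewrite /Defs.ip; congr (_ * _).
rewrite (bigID (fun x => nbr d k x \in omega N)) /= addrC big1 ?add0r.
  by apply: eq_bigr => x /andP[xI _]; rewrite shiftE xI.
by move=> x /andP[xI /Hval_out x0]; rewrite shiftE xI x0 mul0r.
Qed.

Lemma ip_shift_adjoint d k v w : ip (shift d k v) w = ip v (shift (~~ d) k w).
Proof.
rewrite ip_shiftl (ip_sym ip_ok v) ip_shiftl; congr (_ * _).
rewrite (sum_nbr d k (fun x y => Hval v y * Hval w x)).
by apply: eq_bigr => x _; rewrite mulrC.
Qed.

(** After reindexing, the left-hand side sums the same squares over a subset of [omega]. *)
Lemma ip_shift_le d k w : ip (shift d k w) (shift d k w) <= ip w w.
Proof.
rewrite ip_shiftl /Defs.ip ler_pM2l ?prod_h_gt0 //.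
under eq_bigr => x /andP[xI _] do rewrite shiftE xI.
rewrite (sum_nbr d k (fun _ y => Hval w y * Hval w y)).
rewrite [leRHS](bigID (fun x => nbr (~~ d) k x \in omega N)) /= lerDl.
by apply: sumr_ge0 => x _; rewrite -expr2 sqr_ge0.
Qed.

(* A node stepping out of omega in the direction k stays out of omega under a
   step in another direction, so no boundary value is ever read. *)
Lemma Hval_shift_nbr d e k l w x : x \in omega N -> k != l ->
  Hval (shift e l w) (nbr d k x) = Hval w (nbr e l (nbr d k x)).
Proof.
move=> /omegaP xI kl; rewrite shiftE; case: ifPn => // yB.
rewrite Hval_out //; apply: contra yB => /omegaP zI; apply/omegaP => i.
have [->|il] := eqVneq i l; first by rewrite nbr_other // eq_sym.
by have := zI i; rewrite nbr_other.
Qed.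

Lemma shift_commute d e k l : k != l -> lfun_commute (shift d k) (shift e l).
Proof.
move=> kl; apply/lfunP => w; apply: Hval_inj => x; rewrite !comp_lfunE.
rewrite [LHS]shiftE [RHS]shiftE; case: ifP => // xI.
have lk : l != k by rewrite eq_sym.
by rewrite (Hval_shift_nbr _ _ _ xI kl) (Hval_shift_nbr _ _ _ xI lk) nbrC.
Qed.

Lemma Lambda_shift k : Lambda N h k =
  h k ^- 2 *: (shift true k + shift false k - 2 *: \1%VF).
Proof.
apply/lfunP => w; apply: Hval_inj => x; rewrite LambdaE.
rewrite scale_lfunE !add_lfunE opp_lfunE scale_lfunE lfunE /= HvalZ !HvalD.
rewrite -scaleN1r !HvalZ !shiftE; case: ifPn => [_|/Hval_out ->] /=; ring.
Qed.

Lemma sN_Lambda k : sN R N k = \1%VF + (h k ^+ 2 / 12) *: Lambda N h k.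
Proof.
apply/lfunP => w; apply: Hval_inj => x; rewrite sNE.
rewrite add_lfunE scale_lfunE lfunE /= HvalD HvalZ LambdaE.
case: ifPn => [_|/Hval_out ->]; last by rewrite mulr0 addr0.
by field; exact: lt0r_neq0.
Qed.

(** Opposite shifts along one direction need not commute, because of the boundary; equal directions
    are therefore settled by reflexivity, and distinct ones by shifts. *)
Lemma Lambda_commute k l : lfun_commute (Lambda N h k) (Lambda N h l).
Proof.
have [->|kl] := eqVneq k l; first by [].
rewrite !Lambda_shift; apply/lfun_commuteZ/lfun_commuteD; last first.
  exact/lfun_commuteN/lfun_commuteZ/lfun_commute1.
apply: lfun_commuteD; apply/lfun_commute_sym/lfun_commuteZ/lfun_commuteD;
  try exact/lfun_commuteN/lfun_commuteZ/lfun_commute1;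
  by apply: lfun_commuteD; apply: shift_commute; rewrite eq_sym.
Qed.

Lemma Lambda_symmetric k : symmetric_op ip (Lambda N h k).
Proof.
move=> v w; rewrite Lambda_shift !scale_lfunE !add_lfunE !opp_lfunE !scale_lfunE.
by rewrite !lfunE /= !(ipE ip_ok) !ip_shift_adjoint [_ + ip _ (shift _ _ _)]addrC.
Qed.

(** Shifts are contractions, so each of their forms lies between [- ip w w] and [ip w w]; the two
    are added and [2 * ip w w] is subtracted. *)
Lemma Lambda_bounds k w :
  - (4 / h k ^+ 2 * ip w w) <= ip (Lambda N h k w) w <= 0.
Proof.
have shift_le d c : c ^+ 2 = 1 -> c * ip (shift d k w) w <= ip w w.
  move=> c1; have := ip_ge0 ip_ok (c *: shift d k w - w).
  rewrite !(ipE ip_ok) (ip_sym ip_ok w (shift d k w)) mulrA -expr2 c1.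
  have := ip_shift_le d k w; lra.
have h2 : 0 < h k ^- 2 by rewrite invr_gt0 exprn_gt0.
rewrite Lambda_shift !scale_lfunE !add_lfunE !opp_lfunE !scale_lfunE.
rewrite lfunE /= !(ipE ip_ok).
have Np : (-1 : R) ^+ 2 = 1 by ring.
have Pp : (1 : R) ^+ 2 = 1 by ring.
have := shift_le true _ Np; have := shift_le false _ Np.
have := shift_le true _ Pp; have := shift_le false _ Pp.
by rewrite -/(h k ^- 2); nra.
Qed.

End MeshFunctions.

(** * The operators of the scheme *)

Section NumerovOperators.
Variables (R : realType) (n : nat) (N : 'I_n -> nat) (h a : 'I_n -> R) (ht : R).
Hypothesis h_gt0 : forall k, 0 < h k.
Local Notation Hh := (Hh R N).
Local Notation ip := (@ip R n N h).
Local Notation Lambda := (Lambda N h).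
Local Notation sN := (sN R N).
Let ip_ok : inner_product ip := ip_inner_product N h_gt0.

Lemma commute_sN (C : 'End(Hh)) :
  (forall k, lfun_commute C (Lambda k)) -> forall k, lfun_commute C (sN k).
Proof.
move=> CL k; rewrite (sN_Lambda _ h_gt0).
by apply: lfun_commuteD; [exact: lfun_commute1 | exact: lfun_commuteZ].
Qed.

Lemma sN_commute k l : lfun_commute (sN k) (sN l).
Proof.
apply: commute_sN => {}l; apply/lfun_commute_sym/commute_sN => {}k.
exact: Lambda_commute.
Qed.

Lemma sbarN_hatE k : sbarN R N = (sbarN_hat R N k \o sN k)%VF.
Proof.
apply: big_comp_lfunD1; [exact: sN_commute | exact: index_enum_uniq |].
exact: mem_index_enum.
Qed.

Lemma commute_sbarN (C : 'End(Hh)) :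
  (forall k, lfun_commute C (Lambda k)) -> lfun_commute C (sbarN R N).
Proof. by move=> CL; apply: lfun_commute_big; exact: commute_sN. Qed.

Lemma commute_Bh (C : 'End(Hh)) :
  (forall k, lfun_commute C (Lambda k)) -> lfun_commute C (Bh N h a ht).
Proof.
move=> CL; apply: lfun_commuteD; first exact: lfun_commute1.
by apply/lfun_commuteZ/lfun_commute_sum => k; apply: lfun_commuteZ.
Qed.

Lemma sbarN_commute_Lambda k : lfun_commute (sbarN R N) (Lambda k).
Proof. by apply/lfun_commute_sym/commute_sbarN => l; exact: Lambda_commute. Qed.

Lemma Ah_commute_sbarN : lfun_commute (Ah N h a ht) (sbarN R N).
Proof.
apply/lfun_commute_sym/lfun_commute_comp.
  by apply: commute_Bh; exact: sbarN_commute_Lambda.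
apply/lfun_commuteN/lfun_commute_sum => k; apply/lfun_commuteZ.
apply: lfun_commute_comp; last exact: sbarN_commute_Lambda.
apply: lfun_commute_inv; first exact: lker_sN.
exact/commute_sN/sbarN_commute_Lambda.
Qed.

(** [sbarN] passes through [Bh], and in the [k]-th summand its factor [sN k] cancels the inverse,
    leaving [sbarN_hat k]. *)
Lemma AtildeN_sbarN : AtildeN N h a ht = (sbarN R N \o Ah N h a ht)%VF.
Proof.
rewrite /AtildeN /Ah comp_lfunA (commute_Bh sbarN_commute_Lambda) -comp_lfunA.
congr (_ \o _)%VF; rewrite /AbarN; apply/lfunP => w.
rewrite comp_lfunE !opp_lfunE [RHS]linearN; congr (- _).
rewrite !sum_lfunE linear_sum /=.
apply: eq_bigr => k _; rewrite !scale_lfunE linearZ /= !comp_lfunE.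
congr (_ *: _); rewrite (sbarN_hatE k) comp_lfunE.
by rewrite -[sN k _]comp_lfunE lker0_compfV ?lfunE //; exact: lker_sN.
Qed.

Lemma opp_Lambda_psd k : psd_op ip (- Lambda k).
Proof.
split=> [|w]; first by rewrite -scaleN1r; apply/symmetric_opZ/Lambda_symmetric.
by rewrite opp_lfunE (ipNl ip_ok) oppr_ge0; case/andP: (Lambda_bounds h_gt0 k w).
Qed.

Lemma sN_psd k : psd_op ip (sN k).
Proof.
rewrite (sN_Lambda _ h_gt0); split=> [|w].
  apply: symmetric_opD => //; first exact: symmetric_op1.
  exact/symmetric_opZ/Lambda_symmetric.
rewrite add_lfunE scale_lfunE lfunE /= (ipDl ip_ok) (ipZl ip_ok).
have /andP[Lw _] := Lambda_bounds h_gt0 k w.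
have h2 : 0 <= h k ^+ 2 / 12 by rewrite divr_ge0 // sqr_ge0.
have := ler_wpM2l h2 Lw; rewrite mulrN mulrA.
(* The negative part costs at most one third, so [sN k] is at least two thirds of the identity. *)
have -> : h k ^+ 2 / 12 * (4 / h k ^+ 2) = 3^-1 by field; exact: lt0r_neq0.
by have := ip_ge0 ip_ok w; lra.
Qed.

Lemma sbarN_psd : psd_op ip (sbarN R N).
Proof. by apply: psd_op_big => //; [exact: sN_commute | exact: sN_psd]. Qed.

Lemma lker_sbarN : lker (sbarN R N) == 0%VS.
Proof. by apply: big_comp_lfun_lker0 => k; exact: lker_sN. Qed.

(** A root [S] exists, so [xget] does not fall back on 0. This [S] is definite: [S w = 0] gives
    [sbarN w = 0], and [sbarN] is injective. *)
Lemma op_sqrt_sbarN :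
  [/\ self_adjoint h (op_sqrt h (sbarN R N)), pos_def h (op_sqrt h (sbarN R N))
    & (op_sqrt h (sbarN R N) \o op_sqrt h (sbarN R N))%VF = sbarN R N].
Proof.
have [S [psdS SE _]] := psd_op_sqrt ip_ok sbarN_psd.
rewrite /op_sqrt; case: xgetP => [_ _ //|/(_ S)[]].
split=> // [|w w0]; first by case: psdS.
rewrite lt_def; case: (psdS) => _ -> ; rewrite andbT.
apply: contraNneq w0 => /(psd_op_kernel ip_ok psdS) Sw0.
apply/eqP/(lker0P lker_sbarN).
by rewrite -SE comp_lfunE Sw0 !linear0.
Qed.

Lemma nrm_op_sqrt_sbarN w :
  nrm h (op_sqrt h (sbarN R N) w) = Num.sqrt (ip (sbarN R N w) w).
Proof.
by have [sS _ SE] := op_sqrt_sbarN; rewrite -{2}SE comp_lfunE sS.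
Qed.

(** Each [- Lambda k] is at most [4 / h k ^+ 2], and [ht ^+ 2 / 12 * 4] is the [ht ^+ 2 / 3] of the
    condition. *)
Lemma Bh_psd : ht ^+ 2 / 3 * (\sum_k a k ^+ 2 / h k ^+ 2) <= 1 ->
  psd_op ip (Bh N h a ht).
Proof.
move=> cond1; split=> [|w].
  apply: symmetric_opD => //; first exact: symmetric_op1.
  apply: symmetric_opZ => // v w; rewrite !sum_lfunE.
  elim/big_rec2: _ => [|k x y _ xy]; first by rewrite (ip0l ip_ok) (ip0r ip_ok).
  rewrite (ipDl ip_ok) (ipDr ip_ok) xy.
  by rewrite (symmetric_opZ ip_ok _ (Lambda_symmetric _ _)).
rewrite add_lfunE scale_lfunE lfunE /= (ipDl ip_ok) (ipZl ip_ok).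
have : - (4 * (\sum_k a k ^+ 2 / h k ^+ 2)) * ip w w <= ip (Lh N h a w) w.
  rewrite sum_lfunE -mulNr mulr_sumr mulr_suml.
  elim/big_rec2: _ => [|k x y _ xy]; first by rewrite (ip0l ip_ok).
  rewrite (ipDl ip_ok) lerD // scale_lfunE (ipZl ip_ok).
  have /andP[Lw _] := Lambda_bounds h_gt0 k w.
  by have := ler_wpM2l (sqr_ge0 (a k)) Lw; lra.
have ht2 : 0 <= ht ^+ 2 / 12 by rewrite divr_ge0 ?sqr_ge0.
move=> /(ler_wpM2l ht2); have := ler_wpM2r (ip_ge0 ip_ok w) cond1; lra.
Qed.

(** [Bh] commutes with [AbarN], which is a nonnegative combination of products of the commuting
    positive operators [sbarN_hat k] and [- Lambda k]. *)
Lemma AtildeN_psd : ht ^+ 2 / 3 * (\sum_k a k ^+ 2 / h k ^+ 2) <= 1 ->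
  psd_op ip (AtildeN N h a ht).
Proof.
move=> cond1.
have hatL k l : lfun_commute (Lambda l) (sbarN_hat R N k).
  by apply: lfun_commute_big => i; apply: commute_sN => {}i; exact: Lambda_commute.
apply: psd_op_comp => //; last 1 first.
- rewrite /AbarN -sumrN; apply: psd_op_sum => // k; rewrite -scalerN.
  apply: psd_opZ; rewrite ?sqr_ge0 // -comp_lfunNr; apply: psd_op_comp => //.
  + exact/lfun_commuteN/lfun_commute_sym/hatL.
  + by apply: psd_op_big => //; [exact: sN_commute | exact: sN_psd].
  + exact: opp_Lambda_psd.
- apply/lfun_commute_sym/commute_Bh => l; apply/lfun_commute_sym.
  apply/lfun_commuteN/lfun_commute_sum => k; apply/lfun_commuteZ.
  by apply: lfun_commute_comp; [exact: hatL | exact: Lambda_commute].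
- exact: Bh_psd.
Qed.

(** The condition is tested at [S w], with [S] the root of [sbarN]. As [S] commutes with [Ah], the
    form of [Ah] at [S w] is that of [sbarN \o Ah] at [w]. *)
Lemma AtildeN_le_sbarN c : op_le h ((ht ^+ 2 / 4) *: Ah N h a ht) (c *: \1%VF) ->
  forall w, ht ^+ 2 / 4 * ip (AtildeN N h a ht w) w <= c * ip (sbarN R N w) w.
Proof.
move=> cond2 w.
have [S [[sS _] SE /(_ _ Ah_commute_sbarN) AS]] := psd_op_sqrt ip_ok sbarN_psd.
have ASw : Ah N h a ht (S w) = S (Ah N h a ht w) by rewrite -!comp_lfunE AS.
have SSE u : S (S u) = sbarN R N u by rewrite -comp_lfunE SE.
have := cond2 (S w); rewrite !scale_lfunE id_lfunE !(ipZl ip_ok).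
by rewrite ASw -!sS !SSE AtildeN_sbarN [(_ \o Ah _ _ _ _)%VF _]comp_lfunE.
Qed.

End NumerovOperators.

Theorem mainTheorem5 (R : realType) (n : nat) (n_ge1 : (1 <= n)%N)
    (a X : 'I_n -> R) (a_gt0 : forall k, 0 < a k) (X_gt0 : forall k, 0 < X k)
    (T : R) (T_gt0 : 0 < T)
    (M : nat) (M_ge2 : (2 <= M)%N)
    (N : 'I_n -> nat) (N_ge2 : forall k, (2 <= N k)%N)
    (ht : R) (htE : ht = T / M%:R)
    (h : 'I_n -> R) (hE : forall k, h k = X k / (N k)%:R)
    (eps eps0 : R) (eps_ge0 : 0 <= eps) (eps_lt1 : eps < 1)
    (eps0_gt0 : 0 < eps0) (eps0_lt1 : eps0 < 1)
    (cond1 : ht ^+ 2 / 3 * (\sum_k a k ^+ 2 / h k ^+ 2) <= 1 - eps)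
    (cond2 : op_le h ((ht ^+ 2 / 4) *: Ah N h a ht) ((1 - eps0 ^+ 2) *: \1%VF))
    (f : nat -> Hh R N) (b : 'I_n -> nat -> Hh R N) (v0 u1 : Hh R N)
    (v : nat -> Hh R N) (vv : 'I_n -> nat -> Hh R N)
    (v_init : v 0%N = v0)
    (v_main : forall m, (1 <= m <= M.-1)%N ->
      Lambda_t ht v m = Bh N h a ht (\sum_k a k ^+ 2 *: vv k m) + f m)
    (vv_eq : forall k m, (m <= M.-1)%N ->
      sN R N k (vv k m) = Lambda N h k (v m) + b k m)
    (v_start : dt ht v 0 =
      (ht / 2) *: Bh N h a ht (\sum_k a k ^+ 2 *: vv k 0%N)
      + u1 + (ht / 2) *: f 0%N) :
  let At := AtildeN N h a ht in
  let sb := sbarN R N in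
  let g := fun m => f m + beta h a ht b m in
  \big[Num.max/0]_(1 <= m < M.+1)
     Num.sqrt (eps0 ^+ 2 * nrm_op h sb (dt_bar ht v m) ^+ 2
               + nrm_op h At (st_bar v m) ^+ 2)
    <= Num.sqrt (nrm_op h At v0 ^+ 2 + eps0 ^- 2 * nrm_op h sb u1 ^+ 2)
       + 2 / eps0 * L1nrm h ht M (fun m => op_sqrt h sb (g m))
  /\
  forall m, (1 <= m <= M)%N ->
    nrm_op h sb (dt_bar ht v m) ^+ 2
      - ht ^+ 2 / 4 * nrm_op h At (dt_bar ht v m) ^+ 2
      + nrm_op h At (st_bar v m) ^+ 2
    = ip h (At v0) (st v 0) + ip h (sb u1) (dt ht v 0)
      + ht / 2 * ip h (sb (g 0%N)) (dt ht v 0)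
      + 2 * Iht ht m.-1 (fun l => ip h (sb (g l)) (dt_ring ht v l)).
Proof.
move=> At sb g.
have ht_gt0 : 0 < ht by rewrite htE divr_gt0 // ltr0n (leq_trans _ M_ge2).
have h_gt0 k : 0 < h k by rewrite hE divr_gt0 // ltr0n (leq_trans _ (N_ge2 k)).
have M_gt0 : (0 < M)%N := ltnW M_ge2.
have ip_ok : inner_product (@ip R n N h) := ip_inner_product N h_gt0.
have cond1' : ht ^+ 2 / 3 * (\sum_k a k ^+ 2 / h k ^+ 2) <= 1.
  by apply: le_trans cond1 _; rewrite gerBl.
have At_psd : psd_op (@ip R n N h) At := AtildeN_psd N h_gt0 cond1'.
have sb_psd : psd_op (@ip R n N h) sb := sbarN_psd N h_gt0.
have CFL := AtildeN_le_sbarN h_gt0 cond2.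
(* Inverting [sN k] in the Numerov equations eliminates [vv] and separates the data [beta] from
   [- Ah (v m)]. *)
have rhsE m : (m <= M.-1)%N ->
    Bh N h a ht (\sum_k a k ^+ 2 *: vv k m) = beta h a ht b m - Ah N h a ht (v m).
  move=> mM; rewrite /beta /Ah comp_lfunE -linearB /=; congr (Bh _ _ _ _ _).
  rewrite opp_lfunE opprK sum_lfunE -big_split /=; apply: eq_bigr => k _.
  rewrite scale_lfunE -scalerDr comp_lfunE.
  have -> : vv k m = (sN R N k)^-1%VF (sN R N k (vv k m)).
    by rewrite -comp_lfunE lker0_compVf ?id_lfunE //; exact: lker_sN.
  by rewrite vv_eq // linearD addrC.
have AtE w : At w = sb (Ah N h a ht w).
  by rewrite /At AtildeN_sbarN // -comp_lfunE.
(* Applying [sb] replaces [Ah] by [At], as the abstract three-level scheme requires. *)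
have v_step m : (1 <= m <= M.-1)%N -> sb (Lambda_t ht v m) + At (v m) = sb (g m).
  move=> mM; rewrite v_main // rhsE; last by case/andP: mM.
  rewrite AtE -linearD /= /g; congr (sb _).
  by rewrite addrAC subrK addrC.
have v_start' : sb (dt ht v 0) =
    - (ht / 2) *: At (v 0%N) + sb u1 + (ht / 2) *: sb (g 0%N).
  rewrite v_start rhsE // AtE /g.
  rewrite -!linearZ -!linearD /=; congr (sb _).
  rewrite !scalerDr scaleNr scalerN [_ - _]addrC -!addrA; congr (_ + _).
    by rewrite [RHS]linearN [in RHS]linearZ.
  by rewrite addrCA; congr (_ + _); rewrite addrC.
have sqr_nrm C w : psd_op (@ip R n N h) C -> nrm_op h C w ^+ 2 = ip h (C w) w.
  by move=> [_ C_ge0]; rewrite sqr_sqrtr.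
split=> [|m mM].
  have := stability_bound ip_ok sb_psd At_psd ht_gt0 v_step v_start' eps0_gt0 M_gt0 CFL.
  rewrite /L1nrm !sqr_nrm // v_init nrm_op_sqrt_sbarN //.
  under [X in _ -> _ <= _ + _ * (_ + Iht _ _ X)]funext => l
    do rewrite nrm_op_sqrt_sbarN //.
  by under [X in _ -> X <= _]eq_bigr => m _ do rewrite !sqr_nrm //.
have := energy_conservation ip_ok sb_psd At_psd ht_gt0 v_step v_start' mM.
by rewrite /energy !sqr_nrm // -v_init.
Qed.
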